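(* Let $P$ and $Q$ be transition kernels on the same finite labelled state space $S=\{1,\dots,n\}$ with the same labelled action sets $A(s)$ and the same discount factor $\gamma\in(0,1)$. Let $U=\{s\in S:|A(s)|=1\}$ and, for $u\in U$, let $a_u$ be the unique element of $A(u)$. Then $P\equiv_{\mathrm{tr}}Q$ if and only if all of the following hold: (i) $P\equiv_{\mathrm{sa}}Q$; (ii) $P_{s,a}=Q_{s,a}$ for every $a \in A(s)$ whenever $|A(s)|\ge 2$; (iii) if $u\in U$ and $P_{u,a_u}\neq Q_{u,a_u}$, then every action is optimal at every state under $P$ for the state reward $e_u$, i.e. $\operatorname{Opt}_{P,e_u}(s)=A(s)$ for every $s\in S$. Moreover, under (i), condition (iii) is unchanged if $\operatorname{Opt}_{P,e_u}$ is replaced by $\operatorname{Opt}_{Q,e_u}$, i.e. if optimality under $P$ is replaced by optimality under $Q$.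
   Context: $S=\{1,\dots,n\}$ is a finite set of states; each state $s$ has a finite nonempty action set $A(s)$; $\gamma\in(0,1)$ is fixed. A transition kernel $P$ assigns to each $s\in S$, $a\in A(s)$ a row vector $P_{s,a}=P(\cdot\mid s,a)\in\mathbb R^{1\times n}$ with nonnegative entries summing to $1$. A state--action reward is a family of real numbers $r(s,a)$, $s\in S$, $a\in A(s)$. The optimal value $V_{P,r}^*\in\mathbb R^n$ is the unique vector with $V_{P,r}^*(s)=\max_{a\in A(s)}\{r(s,a)+\gamma P_{s,a}V_{P,r}^*\}$ for all $s$, and $\operatorname{Opt}_{P,r}(s)=\arg\max_{a\in A(s)}\{r(s,a)+\gamma P_{s,a}V_{P,r}^*\}\subseteq A(s)$ is the set of optimal actions. A state reward $r:S\to\mathbb R$ is identified with the state--action reward $(s,a)\mapsto r(s)$. For $u\in S$, $e_u$ is the state reward with $e_u(u)=1$ and $e_u(s)=0$ for $s\ne u$. A transition-dependent reward is a family of real numbers $r(s,a,x)$, $s,x\in S$, $a\in A(s)$ ($x$ being the next state). Under a kernel $P$ it induces the state--action reward $\bar r_P(s,a)=\sum_{x\in S}P(x\mid s,a)r(s,a,x)$, and $\operatorname{Opt}_{P,r}$ means $\operatorname{Opt}_{P,\bar r_P}$. $P\equiv_{\mathrm{sa}}Q$ means $\operatorname{Opt}_{P,r}(s)=\operatorname{Opt}_{Q,r}(s)$ for every state--action reward $r$ and every $s\in S$. $P\equiv_{\mathrm{tr}}Q$ means $\operatorname{Opt}_{P,r}(s)=\operatorname{Opt}_{Q,r}(s)$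 for every transition-dependent reward $r$ and every $s\in S$. *)

(* Defs.v *)
From HB Require Import structures.
From mathcomp Require Import all_boot all_order all_algebra.
From mathcomp Require Import boolp classical_sets reals.

Set Implicit Arguments.
Unset Strict Implicit.
Unset Printing Implicit Defensive.

Import Order.TTheory GRing.Theory Num.Theory.
Local Open Scope ring_scope.

Section MDP.

Variables (R : realType) (n : nat) (A : 'I_n -> finType).

Definition kernel := forall s : 'I_n, A s -> 'rV[R]_n.

Definition is_stochastic (p : 'rV[R]_n) : Prop :=
  (forall x, 0 <= p 0 x) /\ \sum_x p 0 x = 1.

Definition is_transition_kernel (P : kernel) : Prop :=
  forall s a, is_stochastic (P s a).

Definition sa_reward := forall s : 'I_n, A s -> R.

Definition tr_reward := forall s : 'I_n, A s -> 'I_n -> R.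

Definition state_reward (r : 'I_n -> R) : sa_reward := fun s _ => r s.

Definition e_reward (u : 'I_n) : 'I_n -> R := fun s => (s == u)%:R.

Definition induced_reward (P : kernel) (r : tr_reward) : sa_reward :=
  fun s a => \sum_x P s a 0 x * r s a x.

Definition Qval (gamma : R) (P : kernel) (r : sa_reward) (V : 'cV[R]_n)
    (s : 'I_n) (a : A s) : R :=
  r s a + gamma * (P s a *m V) 0 0.

Definition is_max (T : finType) (f : T -> R) (m : R) : Prop :=
  (forall a, f a <= m) /\ (exists a, f a = m).

Definition bellman_optimal (gamma : R) (P : kernel) (r : sa_reward)
    (V : 'cV[R]_n) : Prop :=
  forall s, is_max (Qval gamma P r V (s:=s)) (V s 0).

(* The default value 0 of [xget] is never used for a transition kernel with
   nonempty action sets and 0 < gamma < 1: see [Vopt_unique]. *)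
Definition Vopt (gamma : R) (P : kernel) (r : sa_reward) : 'cV[R]_n :=
  xget 0 [set V | bellman_optimal gamma P r V]%classic.

Definition Opt (gamma : R) (P : kernel) (r : sa_reward) (s : 'I_n) :
    {set A s} :=
  [set a | [forall b : A s, Qval gamma P r (Vopt gamma P r) b
                              <= Qval gamma P r (Vopt gamma P r) a]].

Definition Opt_tr (gamma : R) (P : kernel) (r : tr_reward) (s : 'I_n) :
    {set A s} :=
  Opt gamma P (induced_reward P r) s.

Definition sa_equiv (gamma : R) (P Q : kernel) : Prop :=
  forall (r : sa_reward) (s : 'I_n), Opt gamma P r s = Opt gamma Q r s.

Definition tr_equiv (gamma : R) (P Q : kernel) : Prop :=
  forall (r : tr_reward) (s : 'I_n), Opt_tr gamma P r s = Opt_tr gamma Q r s.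

Definition single_action_states : {set 'I_n} := [set s | #|A s| == 1%N].

(* [K] is the kernel with respect to which optimality is measured. *)
Definition differing_rows_neutral (gamma : R) (P Q K : kernel) : Prop :=
  forall u, u \in single_action_states ->
  forall a_u : A u, P u a_u <> Q u a_u ->
  forall s, Opt gamma K (state_reward (e_reward u)) s = [set: A s].

Lemma stochastic_contraction (gamma : R) (D : 'cV[R]_n) :
  0 < gamma < 1 ->
  (forall s, exists2 p, is_stochastic p & D s 0 <= gamma * (p *m D) 0 0) ->
  forall s, D s 0 <= 0.
Proof.
move=> /andP[g0 g1] H s0.
have [i _ imax] := @arg_maxP _ _ _ s0 xpredT (fun i => D i 0) isT.
apply: le_trans (imax s0 isT) _.
have [p [p0 p1] Hp] := H i.
have le_i : (p *m D) 0 0 <= D i 0.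
  rewrite mxE -[leRHS]mul1r -p1 mulr_suml.
  by apply: ler_sum => x _; apply: ler_wpM2l => //; apply: imax.
have := le_trans Hp (ler_wpM2l (ltW g0) le_i).
rewrite -subr_ge0 -{2}[D i 0]mul1r -mulrBl => h.
rewrite leNgt; apply/negP => Dpos.
by move: h; rewrite leNgt nmulr_rlt0 ?subr_lt0 // Dpos.
Qed.

Lemma bellman_unique (gamma : R) (P : kernel) (r : sa_reward) (V W : 'cV[R]_n) :
  0 < gamma < 1 -> is_transition_kernel P ->
  bellman_optimal gamma P r V -> bellman_optimal gamma P r W -> V = W.
Proof.
move=> hg hP; suff le V' W' : bellman_optimal gamma P r V' ->
    bellman_optimal gamma P r W' -> forall s, V' s 0 <= W' s 0.
  by move=> hV hW; apply/colP => s; apply/eqP; rewrite eq_le !le.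
move=> hV hW s; rewrite -subr_le0.
have -> : V' s 0 - W' s 0 = (V' - W') s 0 by rewrite !mxE.
apply: (@stochastic_contraction gamma (V' - W') hg) => {}s.
have [_ [a Va]] := hV s; have [Wa _] := hW s.
exists (P s a) => //; rewrite mulmxBr [leLHS]mxE [(- W') _ _]mxE.
rewrite [in leRHS]mxE [in leRHS](mxE _ (fun _ _ => - _)) mulrBr -Va.
apply: le_trans (lerB (lexx _) (Wa a)) _.
by rewrite /Qval opprD addrACA subrr add0r.
Qed.

Lemma bellman_exists (gamma : R) (P : kernel) (r : sa_reward) :
  0 < gamma < 1 -> (forall s, 0 < #|A s|)%N -> is_transition_kernel P ->
  exists V, bellman_optimal gamma P r V.
Proof.
move=> hg hA hP; have /andP[g0 g1] := hg.
pose policy := {dffun forall s, A s}.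
pose M (d : policy) : 'M[R]_n := \matrix_(s, x) P s (d s) 0 x.
pose B d := 1%:M - gamma *: M d.
pose c (d : policy) : 'cV[R]_n := \col_s r s (d s).
have ME d (V : 'cV[R]_n) s : (M d *m V) s 0 = (P s (d s) *m V) 0 0.
  by rewrite !mxE; apply: eq_bigr => x _; rewrite !mxE.
have Bunit d : B d \in unitmx.
  rewrite -unitmx_tr -row_free_unit -kermx_eq0; apply/eqP/row_matrixP => i.
  rewrite row0; set w := row i _.
  have wB : w *m (B d)^T = 0 by rewrite -row_mul mulmx_ker row0.
  have {wB} Bw : w^T = gamma *: (M d *m w^T).
    apply/eqP; rewrite -subr_eq0 scalemxAl -{1}[w^T]mul1mx -mulmxBl.
    by rewrite -[X in X *m _]trmxK -trmx_mul wB trmx0.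
  suff w0 : w^T = 0 by rewrite -[w]trmxK w0 trmx0.
  have le (v : 'cV[R]_n) : v = gamma *: (M d *m v) -> forall s, v s 0 <= 0.
    move=> Ev; apply: (stochastic_contraction hg) => s.
    by exists (P s (d s)) => //; rewrite {1}Ev mxE ME.
  apply/colP => s; apply/eqP; rewrite [X in _ == X]mxE eq_le (le _ Bw) /=.
  have := le (- w^T); rewrite mulmxN scalerN -Bw => /(_ erefl s).
  by rewrite [X in X <= _]mxE oppr_le0.
pose v d := invmx (B d) *m c d.
have vE d s : v d s 0 = Qval gamma P r (v d) (d s).
  have : B d *m v d = c d by rewrite /v mulKVmx.
  rewrite mulmxBl mul1mx -scalemxAl => /eqP; rewrite subr_eq => /eqP Ev.
  by rewrite {1}Ev /Qval -ME !mxE.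
have a0 s : A s by exact: (enum_val (Ordinal (hA s))).
pose d0 : policy := [ffun s => a0 s].
have [d _ dmax] :=
  @arg_maxP _ _ _ d0 xpredT (fun d => \sum_s v d s 0) isT.
have greedy s : {a : A s | forall b : A s, Qval gamma P r (v d) b
                                        <= Qval gamma P r (v d) a}.
  have [a _ amax] :=
    @arg_maxP _ _ _ (a0 s) xpredT (fun a => Qval gamma P r (v d) a) isT.
  by exists a => b; exact: amax.
pose d' : policy := [ffun s => sval (greedy s)].
have d'max s (a : A s) : Qval gamma P r (v d) a <= Qval gamma P r (v d) (d' s).
  by rewrite ffunE; exact: (svalP (greedy s)).
have dd' s : v d s 0 <= v d' s 0.
  rewrite -subr_le0; have -> : v d s 0 - v d' s 0 = (v d - v d') s 0.
    by rewrite !mxE.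
  apply: (stochastic_contraction hg) => {}s; exists (P s (d' s)) => //.
  rewrite mulmxBr.
  have -> X Y i : (X - Y : 'cV[R]_n) i 0 = X i 0 - Y i 0 by rewrite !mxE.
  have -> (X Y : 'M[R]_1) : (X - Y) 0 0 = X 0 0 - Y 0 0 by rewrite !mxE.
  rewrite mulrBr (vE d) (vE d').
  apply: le_trans (lerB (d'max s (d s)) (lexx _)) _.
  by rewrite /Qval opprD addrACA subrr add0r.
have Ev s : v d' s 0 = v d s 0.
  apply/eqP; rewrite -subr_eq0; apply/eqP.
  apply: (psumr_eq0P (P := xpredT) (F := fun s => v d' s 0 - v d s 0)) => //.
    by move=> i _; rewrite subr_ge0.
  rewrite sumrB; apply/eqP; rewrite eq_le subr_le0 subr_ge0.
  by apply/andP; split; [exact: dmax | exact: ler_sum].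
have EV : v d' = v d by apply/colP.
exists (v d) => s; split=> [a|].
  by rewrite -Ev vE EV d'max.
by exists (d s); rewrite -vE.
Qed.

Lemma Vopt_unique (gamma : R) (P : kernel) (r : sa_reward) :
  0 < gamma < 1 -> (forall s, 0 < #|A s|)%N -> is_transition_kernel P ->
  unique (bellman_optimal gamma P r) (Vopt gamma P r).
Proof.
move=> hg hA hP; have ex := bellman_exists r hg hA hP.
have hV : bellman_optimal gamma P r (Vopt gamma P r) by exact: xgetPex.
by split=> // W; apply: bellman_unique.
Qed.

End MDP.

(* Main.v *)
(** If a row [P_{s,a}] differs from [Q_{s,a}], a transition reward supported on
    [(s,a)] can have mean [0] under [P] and an arbitrary mean [c] under [Q];
    hence transition equivalence, which contains state-action equivalence,
    makes [Opt_P] insensitive to adding [c] to the reward at [(s,a)].  Started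
    from the zero reward this is absurd when [s] has another action, and says
    that [e_s] is neutral when it has none.  Conversely, if all actions are
    optimal for a state reward [g], then adding [g] to any reward shifts all the
    optimal action values at a state by the same amount, and the rewards induced
    under [P] and [Q] differ by a combination of such [g]. *)

Require Import Defs.
From mathcomp Require Import all_boot all_order all_algebra.
From mathcomp Require Import boolp reals.

Import Order.TTheory GRing.Theory Num.Theory.
Local Open Scope ring_scope.

Section OptimalActions.

Context {R : realType} {n : nat} {A : 'I_n -> finType}.
Hypothesis hA : forall s, (0 < #|A s|)%N.
Context {gamma : R}.
Hypothesis hgamma : 0 < gamma < 1.

Implicit Types (P Q : kernel R A) (r : sa_reward R A) (g : 'I_n -> R).

Lemma Opt_ext P r r' : (forall s a, r s a = r' s a) ->
  forall s, Opt gamma P r s = Opt gamma P r' s.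
Proof.
move=> rr' s; suff -> : r = r' by [].
by apply: functional_extensionality_dep => t; apply: functional_extensionality_dep => a.
Qed.

(** By uniqueness of the Bellman solution, any explicit solution [V] may stand in for [Vopt]. *)
Lemma mem_Opt P r V s (a : A s) :
  is_transition_kernel P -> bellman_optimal gamma P r V ->
  (a \in Opt gamma P r s) = (Qval gamma P r V a == V s 0).
Proof.
move=> hP hV; have [_ /(_ V hV) VE] := Vopt_unique r hgamma hA hP.
rewrite inE VE; have [le_V [b Vb]] := hV s.
apply/forallP/eqP => [amax | -> //].
by apply/eqP; rewrite eq_le le_V -Vb amax.
Qed.

(** With no maximum involved, this condition is linear in the pair [(g, W)], unlike Bellman
    optimality. *)
Definition all_actions_attain P g (W : 'cV[R]_n) :=
  forall s (a : A s), W s 0 = Qval gamma P (state_reward g) W a.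

Lemma OptT_attain P g : is_transition_kernel P ->
  (forall s, Opt gamma P (state_reward g) s = [set: A s]) ->
  all_actions_attain P g (Vopt gamma P (state_reward g)).
Proof.
move=> hP OptT s a; have [hV _] := Vopt_unique (state_reward g) hgamma hA hP.
by have := mem_Opt P _ _ s a hP hV; rewrite OptT inE => /esym/eqP.
Qed.

(** Every action value at [t] grows by exactly [W t 0], so [V + W] solves the shifted Bellman
    equation and the comparison of actions is unchanged. *)
Lemma Opt_add_attain P r g W : is_transition_kernel P ->
  all_actions_attain P g W ->
  forall s, Opt gamma P (fun t a => r t a + g t) s = Opt gamma P r s.
Proof.
move=> hP hW s; have [hV _] := Vopt_unique r hgamma hA hP.
set V := Vopt _ _ _ in hV.
have QE t (a : A t) : Qval gamma P (fun t a => r t a + g t) (V + W) a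
                      = Qval gamma P r V a + W t 0.
  by rewrite (hW t a) /Qval mulmxDr [(_ + _ : 'M_1) 0 0]mxE mulrDr addrACA.
have hVW : bellman_optimal gamma P (fun t a => r t a + g t) (V + W).
  move=> t; rewrite mxE; have [le_V [b Vb]] := hV t.
  split=> [a|]; first by rewrite QE lerD2r.
  by exists b; rewrite QE Vb.
apply/setP => a; rewrite (mem_Opt P _ _ s a hP hVW) (mem_Opt P _ _ s a hP hV).
by rewrite QE mxE (inj_eq (addIr _)).
Qed.

(** Superposition: [g] is the combination of the [e_reward R u] with coefficients [g u], and
    vanishing coefficients make their [W u] irrelevant. *)
Lemma attain_sum P g (W : 'I_n -> 'cV[R]_n) :
  (forall u, g u != 0 -> all_actions_attain P (e_reward R u) (W u)) ->
  all_actions_attain P g (\sum_u g u *: W u).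
Proof.
move=> hW s a; rewrite /Qval /state_reward mulmx_sumr !summxE mulr_sumr.
have -> : g s = \sum_u g u * e_reward R u s.
  rewrite (bigD1 s) //= big1 ?addr0 /e_reward ?eqxx ?mulr1 // => u us.
  by rewrite eq_sym (negPf us) mulr0.
rewrite -big_split; apply: eq_bigr => u _ /=.
rewrite mxE -scalemxAr mxE; have [->|gu] := eqVneq (g u) 0.
  by rewrite !mul0r mulr0 addr0.
by rewrite (hW u gu s a) mulrDr [gamma * (_ * _)]mulrCA.
Qed.

(** Since [b : A t] and [a : A s] have different types, they are compared as tagged pairs. *)
Definition bump_reward s (a : A s) (c : R) : sa_reward R A :=
  fun t b => c * (Tagged A b == Tagged A a)%:R.

Lemma zero_optimal P r : (forall s a, r s a <= 0) ->
  (forall s, exists a, r s a = 0) -> bellman_optimal gamma P r 0.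
Proof.
move=> r_le0 r0 s; have [a ra] := r0 s; rewrite mxE.
have QE b : Qval gamma P r 0 b = r s b by rewrite /Qval mulmx0 mxE mulr0 addr0.
by split=> [b|]; [rewrite QE | exists a; rewrite QE].
Qed.

Lemma inhabited_actions s : A s.
Proof. exact: enum_val (Ordinal (hA s)). Qed.

Lemma Opt0 P s : is_transition_kernel P ->
  Opt gamma P (fun _ _ => 0) s = [set: A s].
Proof.
move=> hP; apply/setP => a; rewrite (mem_Opt P _ 0) ?inE.
- by rewrite /Qval mulmx0 !mxE mulr0 addr0 eqxx.
- by [].
- by apply: zero_optimal => // t; exists (inhabited_actions t).
Qed.

Lemma tr_sa_equiv P Q : is_transition_kernel P -> is_transition_kernel Q ->
  tr_equiv gamma P Q -> sa_equiv gamma P Q.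
Proof.
move=> hP hQ trPQ r s; have := trPQ (fun t a _ => r t a) s.
have E K : is_transition_kernel K ->
    Opt_tr gamma K (fun t a _ => r t a) s = Opt gamma K r s.
  move=> hK; apply: Opt_ext => t a; rewrite /induced_reward -mulr_suml.
  by have [_ ->] := hK t a; rewrite mul1r.
by rewrite !E.
Qed.

Lemma Opt_bump P Q s (a : A s) (c : R) :
  is_transition_kernel P -> is_transition_kernel Q ->
  tr_equiv gamma P Q -> P s a <> Q s a ->
  forall t, Opt gamma P (bump_reward s a c) t = [set: A t].
Proof.
move=> hP hQ trPQ neq t.
have [x neqx] : exists x, P s a 0 x != Q s a 0 x.
  apply: contrapT => noex; apply: neq; apply/rowP => x.
  by apply: contrapT => /eqP nx; apply: noex; exists x.
(* The indicator of [x] is centred at its [P]-mean, giving mean 0 under [P] at [(s, a)]; [k] scales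
   the mean under [Q] to [c]. *)
pose k := c / (Q s a 0 x - P s a 0 x).
pose r : tr_reward R A := fun v b y =>
  k * ((y == x)%:R - P s a 0 x) * (Tagged A b == Tagged A a)%:R.
have E K v (b : A v) : is_transition_kernel K -> induced_reward K r b
    = k * (K v b 0 x - P s a 0 x) * (Tagged A b == Tagged A a)%:R.
  move=> hK; rewrite /induced_reward; under eq_bigr do rewrite mulrA mulrCA.
  rewrite -mulr_suml -mulr_sumr; congr (_ * _ * _).
  under eq_bigr do rewrite mulrBr.
  rewrite sumrB -mulr_suml; have [_ ->] := hK v b; rewrite mul1r.
  congr (_ - _); rewrite (bigD1 x) //= eqxx mulr1 big1 ?addr0 // => y yx.
  by rewrite (negPf yx) mulr0.
have row_eq (K : kernel R A) v (b : A v) :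
    Tagged A b = Tagged A a -> K v b 0 x = K s a 0 x.
  by move=> ba; have := congr1 (fun z : {w : 'I_n & A w} => K (tag z) (tagged z) 0 x) ba.
(* Chain: the bump under [P], the bump under [Q], [r] under [Q], [r] under [P], the zero reward
   under [P]. *)
rewrite (tr_sa_equiv _ _ hP hQ trPQ) -(Opt0 P t hP).
transitivity (Opt_tr gamma Q r t).
  apply: Opt_ext => v b; rewrite (E Q) // /bump_reward.
  have [/row_eq ->|_] := eqVneq; last by rewrite !mulr0.
  by rewrite /k divfK // subr_eq0 eq_sym.
rewrite -trPQ; apply: Opt_ext => v b; rewrite (E P) //.
have [/row_eq ->|_] := eqVneq; last by rewrite mulr0.
by rewrite subrr mulr0 mul0r.
Qed.

Lemma tr_equiv_rows P Q : is_transition_kernel P -> is_transition_kernel Q ->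
  tr_equiv gamma P Q ->
  forall s, (2 <= #|A s|)%N -> forall a : A s, P s a = Q s a.
Proof.
move=> hP hQ trPQ s s2 a; apply: contrapT => neq.
have [b ba] : exists b, b != a.
  have /card_gt0P[b] : (0 < #|predC1 a|)%N by rewrite cardC1; case: #|A s| s2 => [|[]].
  by exists b.
(* Penalising [a] leaves the optimal value at 0, thanks to [b], but gives [a] the value -1, so [a]
   cannot be optimal. *)
have := Opt_bump P Q s a (- 1) hP hQ trPQ neq s => /setP/(_ a).
rewrite (mem_Opt P _ 0) // ?inE.
  rewrite /Qval mulmx0 !mxE mulr0 addr0 /bump_reward eqxx mulr1 oppr_eq0.
  by rewrite oner_eq0.
apply: zero_optimal => [t d | t]; rewrite /bump_reward.
  by rewrite mulN1r oppr_le0 ler0n.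
have [<-{t}|st] := eqVneq s t.
  by exists b; rewrite eq_Tagged (negPf ba) mulr0.
exists (inhabited_actions t).
suff /negPf -> : Tagged A (inhabited_actions t) != Tagged A a by rewrite mulr0.
by apply: contraNneq st => /(congr1 tag) /= ->.
Qed.

Lemma card1_eq s (a b : A s) : #|A s| = 1%N -> a = b.
Proof. by move=> s1; apply: fintype_le1P; rewrite s1. Qed.

Lemma tr_equiv_neutral P Q : is_transition_kernel P -> is_transition_kernel Q ->
  tr_equiv gamma P Q -> differing_rows_neutral gamma P Q P.
Proof.
move=> hP hQ trPQ u; rewrite inE => /eqP u1 a neq s.
rewrite -(Opt_bump P Q u a 1 hP hQ trPQ neq s).
(* As [a] is the only action at [u], the unit bump at [(u, a)] is the state reward of [u]. *)
apply: Opt_ext => t b; rewrite /bump_reward mul1r /state_reward /e_reward.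
have [tu|tu] := eqVneq t u.
  by case: _ / (esym tu) b => b; rewrite (card1_eq _ b a u1) eqxx.
suff /negPf -> : Tagged A b != Tagged A a by [].
by apply: contraNneq tu => /(congr1 tag) /= ->.
Qed.

Lemma tr_equiv_of_neutral P Q :
  is_transition_kernel P -> is_transition_kernel Q -> sa_equiv gamma P Q ->
  (forall s, (2 <= #|A s|)%N -> forall a : A s, P s a = Q s a) ->
  differing_rows_neutral gamma P Q P -> tr_equiv gamma P Q.
Proof.
move=> hP hQ saPQ rows neutral r s; rewrite /Opt_tr -saPQ.
(* The choice of action is harmless: it is forced at a single-action state, and elsewhere the rows
   agree, so [g u] is 0. *)
pose g u := induced_reward Q r (inhabited_actions u)
            - induced_reward P r (inhabited_actions u).
have card1 u : ~~ (2 <= #|A u|)%N -> #|A u| = 1%N.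
  by have := hA u; case: #|A u| => [|[]].
have rE t (a : A t) : induced_reward Q r a = induced_reward P r a + g t.
  have [/rows eqt|/card1 t1] := boolP (2 <= #|A t|)%N.
    by rewrite /g /induced_reward !eqt subrr addr0.
  by rewrite (card1_eq _ a (inhabited_actions t) t1) addrC subrK.
rewrite (Opt_ext P _ _ rE).
symmetry; apply: (Opt_add_attain P _ g _ hP); apply: attain_sum => u gu.
have neq : P u (inhabited_actions u) <> Q u (inhabited_actions u).
  by move=> eqrow; move: gu; rewrite /g /induced_reward eqrow subrr eqxx.
apply: OptT_attain => //; apply: (neutral u _ _ neq).
rewrite inE; apply/eqP/card1/negP => u2; exact: neq (rows u u2 _).
Qed.

End OptimalActions.

Theorem theorem4p2 (R : realType) (n : nat) (A : 'I_n -> finType)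
    (hA : forall s, (0 < #|A s|)%N)
    (gamma : R) (hgamma : 0 < gamma < 1)
    (P Q : kernel R A)
    (hP : is_transition_kernel P) (hQ : is_transition_kernel Q) :
  (tr_equiv gamma P Q <->
    [/\ sa_equiv gamma P Q,
        (forall s, (2 <= #|A s|)%N -> forall a : A s, P s a = Q s a)
      & differing_rows_neutral gamma P Q P])
  /\ (sa_equiv gamma P Q ->
       (differing_rows_neutral gamma P Q P <->
        differing_rows_neutral gamma P Q Q)).
Proof.
split; last first.
  move=> saPQ; split=> neutral u u1 a neq s; [rewrite -saPQ | rewrite saPQ];
  exact: (neutral u u1 a neq s).
split=> [trPQ | [saPQ rows neutral]].
  split; first exact: (tr_sa_equiv P Q hP hQ trPQ).
    exact: (tr_equiv_rows hA hgamma P Q hP hQ trPQ).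
  exact: (tr_equiv_neutral hA hgamma P Q hP hQ trPQ).
exact: (tr_equiv_of_neutral hA hgamma P Q).
Qed.
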